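(* Let $k,n$ be integers with $n$ odd, and let $A \in \Lambda^{4k}_n$. Then $\operatorname{per} A \equiv 0 \pmod 4$.
   Context: $\Lambda_n^{m}$ denotes the set of all $(0,1)$-matrices of order $n$ (i.e. $n\times n$) that contain exactly $m$ ones in each row and each column. The permanent of an $n\times n$ matrix $A=[a_{ij}]$ is $\operatorname{per} A=\sum_{\sigma\in \mathcal{S}_n}\prod_{i=1}^n a_{i\sigma(i)}$, where $\mathcal{S}_n$ is the symmetric group on $\{1,\dots,n\}$. *)

(* Defs.v *)
From mathcomp Require Import all_boot all_order all_fingroup all_algebra.
Set Implicit Arguments.
Unset Strict Implicit.
Unset Printing Implicit Defensive.
Import GRing.Theory.
Local Open Scope ring_scope.

Definition permanent (R : comPzSemiRingType) (n : nat) (A : 'M[R]_n) : R :=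
  \sum_(s : 'S_n) \prod_i A i (s i).

Definition Lambda (n m : nat) : {pred 'M[int]_n} :=
  [pred A : 'M[int]_n |
    [&& [forall i, forall j, (A i j == 0) || (A i j == 1)],
        [forall i, #|[set j | A i j == 1]| == m]
      & [forall j, #|[set i | A i j == 1]| == m]]].

Arguments Lambda : clear implicits.

(* Main.v *)
Require Import Defs.
From mathcomp Require Import all_boot all_order all_fingroup all_algebra.
From mathcomp Require Import ring.
Set Implicit Arguments.
Unset Strict Implicit.
Unset Printing Implicit Defensive.
Import GRing.Theory.
Local Open Scope ring_scope.

(** The matrix enters through its line sums: the argument applies to an integer
    matrix of odd order whose row sums are divisible by 4 and whose column sums
    are even ([permanent_mod4]).

    Fix a column [l].  Let [a_j] be column [j] of [A], and let [D j] be the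
    permanent after column [l] is replaced by [a_j], so that [D l = per A].  By
    linearity in column [l], the sum of all the [D j] is the permanent after
    column [l] is replaced by the vector of row sums, hence is 0 mod 4.  The key
    fact is that for [j != l], where the replaced matrix has two equal columns,
    [D j] is congruent mod 4 to [2 * c], with a value [c] independent of [j]:
    the permanent after column [l] is replaced by a unit vector.  Thus
    [per A = - (n - 1) * 2 * c] mod 4, which vanishes because [n - 1] is even.

    The key fact ([permanent_repeated_col]) concerns the symmetric bilinear form
    [B x y], the permanent with [x] and [y] put in columns [j] and [l].  Modulo
    2 the permanent is a determinant, which vanishes when all column sums are
    even ([permanent_even]); so [B] is even on vectors with even sum, and on
    those vectors the quadratic map [x |-> B x x] is additive mod 4.  It can
    therefore be compared with the additive map [x |-> 2 * B x e_r] on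
    generators of the lattice of vectors with even sum. *)

(** * Permanents as functions of one or two columns *)

Definition set_col (R : Type) (n : nat) (A : 'M[R]_n) (l : 'I_n)
    (y : 'cV[R]_n) : 'M[R]_n :=
  \matrix_(i, j) if j == l then y i 0 else A i j.

Lemma set_col_id (R : Type) (n : nat) (A : 'M[R]_n) (l : 'I_n) :
  set_col A l (col l A) = A.
Proof. by apply/matrixP => i j; rewrite !mxE; case: eqP => // ->. Qed.

Lemma xcol_set_col2 (R : Type) (n : nat) (A : 'M[R]_n) (j l : 'I_n)
    (x y : 'cV[R]_n) : j != l ->
  xcol j l (set_col (set_col A j x) l y) = set_col (set_col A j y) l x.
Proof.
move=> neq_jl; apply/matrixP => i t; rewrite !mxE.
case: tpermP => [->|->|/eqP/negPf tj /eqP/negPf tl].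
- by rewrite (negPf neq_jl) !eqxx.
- by rewrite (negPf neq_jl) !eqxx.
- by rewrite tj tl.
Qed.

Lemma permanent_tr (R : comPzSemiRingType) (n : nat) (A : 'M[R]_n) :
  permanent A^T = permanent A.
Proof.
rewrite /permanent (reindex_inj invg_inj) /=; apply: eq_bigr => s _.
rewrite (reindex_inj (@perm_inj _ s)) /=.
by apply: eq_bigr => i _; rewrite mxE permK.
Qed.

Lemma permanent_xcol (R : comPzSemiRingType) (n : nat) (A : 'M[R]_n)
    (j l : 'I_n) :
  permanent (xcol j l A) = permanent A.
Proof.
rewrite /permanent [RHS](reindex_inj (mulIg (tperm j l))) /=.
by apply: eq_bigr => s _; apply: eq_bigr => i _; rewrite mxE permM.
Qed.

Lemma permanent_set_col (R : comPzSemiRingType) (n : nat) (A : 'M[R]_n)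
    (l : 'I_n) (y : 'cV[R]_n) :
  permanent (set_col A l y) =
  \sum_(s : 'S_n) y (s l) 0 * \prod_(j | j != l) A (s j) j.
Proof.
rewrite -permanent_tr; apply: eq_bigr => s _.
rewrite (bigD1 l) //= !mxE eqxx; congr (_ * _).
by apply: eq_bigr => j /negPf neq_jl; rewrite !mxE neq_jl.
Qed.

Lemma permanent_set_colD (R : comPzSemiRingType) (n : nat) (A : 'M[R]_n)
    (l : 'I_n) (x y : 'cV[R]_n) :
  permanent (set_col A l (x + y)) =
  permanent (set_col A l x) + permanent (set_col A l y).
Proof.
rewrite !permanent_set_col -big_split; apply: eq_bigr => s _ /=.
by rewrite mxE mulrDl.
Qed.

Lemma permanent_set_colZ (R : comPzSemiRingType) (n : nat) (A : 'M[R]_n)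
    (l : 'I_n) (a : R) (y : 'cV[R]_n) :
  permanent (set_col A l (a *: y)) = a * permanent (set_col A l y).
Proof.
rewrite !permanent_set_col mulr_sumr; apply: eq_bigr => s _ /=.
by rewrite mxE mulrA.
Qed.

Lemma permanent_set_col0 (R : comPzSemiRingType) (n : nat) (A : 'M[R]_n)
    (l : 'I_n) :
  permanent (set_col A l 0) = 0.
Proof. by rewrite -(scale0r 0) permanent_set_colZ mul0r. Qed.

Lemma permanent_set_col2C (R : comPzSemiRingType) (n : nat) (A : 'M[R]_n)
    (j l : 'I_n) (x y : 'cV[R]_n) : j != l ->
  permanent (set_col (set_col A j x) l y) =
  permanent (set_col (set_col A j y) l x).
Proof. by move=> neq_jl; rewrite -xcol_set_col2 // permanent_xcol. Qed.

(** In a nonzero term the permutation would have to send both [j] and [l] to [r]. *)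
Lemma permanent_set_col2_delta (R : comPzSemiRingType) (n : nat) (A : 'M[R]_n)
    (j l r : 'I_n) : j != l ->
  permanent (set_col (set_col A j (delta_mx r 0)) l (delta_mx r 0)) = 0.
Proof.
move=> neq_jl; rewrite permanent_set_col big1 // => s _.
rewrite (bigD1 j) //= !mxE !eqxx !andbT mulrA.
case: eqVneq => [sl_r|]; last by rewrite !mul0r.
case: eqVneq => [sj_r|]; last by rewrite mulr0 mul0r.
by rewrite -sl_r in sj_r; rewrite (perm_inj sj_r) eqxx in neq_jl.
Qed.

(** * Congruences for integer matrices *)

(** Signs disappear in characteristic 2, so the permanent and the determinant
    agree there, and the all-ones row vector is in the left kernel of the
    reduced matrix.  The index [l] makes this vector nonzero; the empty matrix
    has permanent 1. *)
Lemma permanent_even (n : nat) (A : 'M[int]_n) (l : 'I_n) :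
  (forall j, (2 %| \sum_i A i j)%Z) -> (2 %| permanent A)%Z.
Proof.
move=> even_cols.
have F2 : 2%N \in [pchar 'F_2] by apply: pchar_Fp.
rewrite (dvdz_pcharf F2).
have -> : (permanent A)%:~R = \det (map_mx (intr : int -> 'F_2) A).
  rewrite rmorph_sum; apply: eq_bigr => s _ /=.
  rewrite -mulrC rmorph_prod oppr_pchar2 // expr1n mulr1.
  by apply: eq_bigr => i _; rewrite mxE.
apply/det0P; exists (const_mx 1).
  by apply/eqP => /matrixP/(_ 0 l); rewrite !mxE; apply/eqP/oner_neq0.
apply/matrixP => i j; rewrite !mxE; apply/eqP.
have := even_cols j; rewrite (dvdz_pcharf F2) rmorph_sum /=.
by congr (_ == 0); apply: eq_bigr => t _; rewrite !mxE mul1r.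
Qed.

(** With [B] the bilinear form given by columns [j] and [l], the claim reads
    [B x x = 2 * B x e_r] mod 4.  On vectors with even sum both sides are
    additive, the left one because the cross term [2 * B y z] is divisible by 4;
    the generators [e_i - e_r] and [2 *: e_r] of this lattice are checked
    directly, using [B e_i e_i = 0]. *)
Lemma permanent_repeated_col (n : nat) (A : 'M[int]_n) (j l r : 'I_n)
    (x : 'cV[int]_n) : j != l ->
  (forall t, (2 %| \sum_i A i t)%Z) -> (2 %| \sum_i x i 0%R)%Z ->
  (4 %| permanent (set_col (set_col A j x) l x)
        - 2 * permanent (set_col (set_col A j x) l (delta_mx r 0%R)))%Z.
Proof.
move=> neq_jl even_A.
pose B y z := permanent (set_col (set_col A j y) l z).
pose e i : 'cV[int]_n := delta_mx i 0.
pose even y := (2 %| \sum_i (y : 'cV[int]_n) i 0%R)%Z.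
have BC y z : B y z = B z y by apply: permanent_set_col2C.
have BDr y z w : B y (z + w) = B y z + B y w by apply: permanent_set_colD.
have BZr a y z : B y (a *: z) = a * B y z by apply: permanent_set_colZ.
have BDl y z w : B (y + z) w = B y w + B z w by rewrite BC BDr !(BC w).
have BZl a y z : B (a *: y) z = a * B y z by rewrite BC BZr BC.
have B_alt i : B (e i) (e i) = 0 by apply: permanent_set_col2_delta.
have B_even y z : even y -> even z -> (2 %| B y z)%Z.
  move=> even_y even_z; apply: permanent_even => // t.
  under eq_bigr do rewrite !mxE.
  by case: (t == l); case: (t == j).
pose good y := even y /\ (4 %| B y y - 2 * B y (e r))%Z.
have good0 : good 0.
  have B0 y : B 0 y = 0 by rewrite BC /B permanent_set_col0.
  by split; rewrite ?B0 ?mulr0 // /even big1 // => i _; rewrite mxE.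
have goodD y z : good y -> good z -> good (y + z).
  move=> [even_y By] [even_z Bz]; split.
    rewrite /even; under eq_bigr do rewrite mxE.
    by rewrite big_split rpredD.
  have /dvdzP[b Byz] := B_even y z even_y even_z.
  have -> : B (y + z) (y + z) - 2 * B (y + z) (e r)
    = (B y y - 2 * B y (e r)) + (B z z - 2 * B z (e r)) + b * 4.
    by rewrite !BDl !BDr (BC z y) Byz; ring.
  by apply: rpredD; [exact: rpredD | exact: dvdz_mull].
have goodZ a y : good y -> good (a *: y).
  move=> [even_y By]; split.
    rewrite /even; under eq_bigr do rewrite mxE.
    by rewrite -mulr_sumr dvdz_mull.
  (* The two sides scale by [a * a] and [a], which differ by an even number;
     the factor 2 in [2 * B y (e r)] makes the discrepancy divisible by 4. *)
  have [c aa] : exists c, a * a - a = c * 2.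
    apply/dvdzP; rewrite (dvdz_pcharf (pchar_Fp (isT : prime 2))).
    have idem (z : 'F_2) : z * z - z == 0 by case: z => [[|[|]]].
    by rewrite rmorphB rmorphM; apply: idem.
  have -> : B (a *: y) (a *: y) - 2 * B (a *: y) (e r)
    = a * a * (B y y - 2 * B y (e r)) + c * B y (e r) * 4.
    by move/eqP: aa; rewrite subr_eq !BZl !BZr mulrA => /eqP->; ring.
  by apply: rpredD; exact: dvdz_mull.
have sum_e i : \sum_t e i t 0 = 1.
  rewrite (bigD1 i) //= big1 => [|t /negPf neq_ti]; rewrite !mxE ?neq_ti //.
  by rewrite !eqxx addr0.
have good_diff i : good (e i - e r).
  split.
    rewrite /even; under eq_bigr do rewrite mxE [X in _ + X]mxE.
    by rewrite big_split sumrN /= !sum_e subrr.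
  have -> : e i - e r = e i + (-1) *: e r by rewrite scaleN1r.
  rewrite !BDl !BDr !BZl !BZr !B_alt (BC (e r)).
  by apply/dvdzP; exists (- B (e i) (e r)); ring.
have good_double : good (2 *: e r).
  split; last by rewrite !BZl !BZr B_alt !mulr0.
  rewrite /even; under eq_bigr do rewrite mxE.
  by rewrite -mulr_sumr sum_e.
(* [x] is the combination of the [e_i - e_r] with its own coefficients, plus
   its sum times [e_r], and that sum is [c * 2]. *)
move=> /dvdzP[c sum_x].
suff [] : good x by [].
have -> : x = \sum_i x i 0 *: (e i - e r) + c *: (2 *: e r).
  under eq_bigr do rewrite scalerBr.
  rewrite sumrB -scaler_suml sum_x scalerA subrK.
  apply/colP => t; rewrite summxE (bigD1 t) //= big1 ?addr0 => [|i /negPf it].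
    by rewrite !mxE !eqxx mulr1.
  by rewrite !mxE eq_sym it mulr0.
apply: (goodD _ _); last exact: goodZ.
by apply: (big_ind good) => // i _; apply: goodZ.
Qed.

(** The [n - 1] columns other than [l] contribute [2 * c] each, so an even
    [n - 1] makes their total divisible by 4. *)
Lemma permanent_mod4 (n : nat) (A : 'M[int]_n) : odd n ->
  (forall i, (4 %| \sum_j A i j)%Z) -> (forall j, (2 %| \sum_i A i j)%Z) ->
  (4 %| permanent A)%Z.
Proof.
case: n A => // n A odd_n rows cols.
pose l : 'I_n.+1 := ord0; pose c := permanent (set_col A l (delta_mx l 0)).
pose D j := permanent (set_col A l (col j A)).
have Dl : D l = permanent A by rewrite /D set_col_id.
have D_mod j : j != l -> (4 %| D j - 2 * c)%Z.
  move=> neq_jl.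
  have := @permanent_repeated_col _ A j l l (col j A) neq_jl cols.
  rewrite set_col_id; apply.
  by under eq_bigr do rewrite mxE.
have sumD : (4 %| \sum_j D j)%Z.
  have -> : \sum_j D j = permanent (set_col A l (\sum_j col j A)).
    apply/esym/(big_morph (fun y => permanent (set_col A l y))).
      by move=> x y; apply: permanent_set_colD.
    exact: permanent_set_col0.
  rewrite permanent_set_col rpred_sum // => s _.
  rewrite dvdz_mulr // summxE.
  by under eq_bigr do rewrite mxE.
have : (4 %| \sum_(j | j != l) (D j - 2 * c))%Z by apply: rpred_sum.
move: sumD; rewrite (bigD1 l) //= Dl sumrB sumr_const cardC1 card_ord.
have n_even : (2 * c) *+ n = (n./2%:Z * c) * 4.
  rewrite -[in LHS](even_halfK (odd_n : ~~ odd n)) -mulr_natr -muln2 natrM natz.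
  by ring.
set S := \sum_(_ | _) _ => sumD diffD.
have -> : permanent A
  = (permanent A + S) - (S - (2 * c) *+ n) - (2 * c) *+ n by ring.
by apply: rpredB; [exact: rpredB | rewrite n_even dvdz_mull].
Qed.

Theorem corollary22 (k n : nat) (hn : odd n) (A : 'M[int]_n)
  (hA : A \in Lambda n (4 * k)%N) :
  (permanent A = 0 %[mod 4])%Z.
Proof.
have /and3P[/forallP A01 /forallP rows /forallP cols] := hA.
have A_ind i j : A i j = (A i j == 1)%:R.
  by have /forallP/(_ j)/orP[] := A01 i; move/eqP->.
have row_sum i : \sum_j A i j = k%:Z * 4.
  under eq_bigr do rewrite A_ind.
  rewrite -natr_sum -big_mkcond /= sum1_card -cardsE (eqP (rows i)).
  by rewrite mulnC natrM natz.
have col_sum j : \sum_i A i j = k%:Z * 4.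
  under eq_bigr do rewrite A_ind.
  rewrite -natr_sum -big_mkcond /= sum1_card -cardsE (eqP (cols j)).
  by rewrite mulnC natrM natz.
apply/eqP; rewrite eqz_mod_dvd subr0; apply: permanent_mod4 => // t.
  by rewrite row_sum dvdz_mull.
by rewrite col_sum dvdz_mull.
Qed.
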